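(* Consider the problem $$\min_{x_1,\dots,x_n}\ \sum_{i=1}^n f_i(x_i)\quad\text{s.t.}\quad \sum_{i=1}^n \mathcal{A}_i(x_i)=b .$$ If $\{\beta_k\}$ is non-decreasing and $\sum_{k=1}^{+\infty}\beta_k^{-1}=+\infty$, and if for $i=1,\dots,n$ one has $\eta_i>n\|\mathcal{A}_i\|^2$ and the subdifferential $\partial f_i$ is bounded, then the sequence $\{(x_1^k,\dots,x_n^k)\}_{k\ge0}$ generated by LADMPSAP (from any initial point $(x_1^0,\dots,x_n^0,\lambda^0)$) converges to an optimal solution of the problem.
   Context: Problem data: $f_i:\mathbb{R}^{d_i}\to\mathbb{R}\cup\{+\infty\}$ are closed proper convex functions, $\mathcal{A}_i:\mathbb{R}^{d_i}\to\mathbb{R}^m$ are linear mappings with adjoints $\mathcal{A}_i^\dagger$ and operator norms $\|\mathcal{A}_i\|$, and $b\in\mathbb{R}^m$; $\|\cdot\|$ on vectors (or matrices) is the Euclidean (Frobenius) norm. ''$\partial f_i$ is bounded'' means there is a constant $M$ with $\|p\|\le M$ for all $x$ and all $p\in\partial f_i(x)$. Standing assumptions: no $\mathcal{A}_i$ is the zero mapping; the solution of $\sum_i\mathcal{A}_i(x_i)=b$ is non-unique; the mapping $(x_1,\dots,x_n)\mapsto\sum_i\mathcal{A}_i(x_i)$ is onto $\mathbb{R}^m$; the problem has a KKT point, i.e. some $(x_1^*,\dots,x_n^*,\lambda^* )$ with $\sum_i\mathcal{A}_i(x_i^* )=b$ and $-\mathcal{A}_i^\dagger(\lambda^* )\in\partial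 f_i(x_i^* )$ for all $i$. LADMPSAP, with parameters $\eta_i>0$ and penalty parameters $\beta_k>0$, run without stopping: given $(x_1^k,\dots,x_n^k,\lambda^k)$, set $$\hat\lambda^k=\lambda^k+\beta_k\Big(\sum_{i=1}^n\mathcal{A}_i(x_i^k)-b\Big),$$ $$x_i^{k+1}=\operatorname*{argmin}_{x_i}\ f_i(x_i)+\frac{\eta_i\beta_k}{2}\Big\|x_i-x_i^k+\frac{\mathcal{A}_i^\dagger(\hat\lambda^k)}{\eta_i\beta_k}\Big\|^2,\quad i=1,\dots,n,$$ $$\lambda^{k+1}=\lambda^k+\beta_k\Big(\sum_{i=1}^n\mathcal{A}_i(x_i^{k+1})-b\Big).$$ The positive penalty sequence $\{\beta_k\}$ enters the result only through the hypotheses stated on it (it may be bounded or unbounded). *)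

(* Defs.v *)
From HB Require Import structures.
From mathcomp Require Import all_boot all_order all_algebra.
From mathcomp Require Import all_classical all_reals all_analysis.

Set Implicit Arguments.
Unset Strict Implicit.
Unset Printing Implicit Defensive.

Import Order.TTheory GRing.Theory Num.Theory.
Import numFieldNormedType.Exports.

Local Open Scope classical_set_scope.
Local Open Scope ring_scope.

Definition dot (R : realType) (d : nat) (u v : 'cV[R]_d) : R :=
  \sum_(i < d) u i 0 * v i 0.

(* The canonical norm of MathComp-Analysis on matrices is the sup norm; it
   induces the same topology, but the constants here are Euclidean. *)
Definition enorm (R : realType) (d : nat) (u : 'cV[R]_d) : R :=
  Num.sqrt (dot u u).

Definition op_norm (R : realType) (d m : nat)
    (A : {linear 'cV[R]_d -> 'cV[R]_m}) : R :=
  sup [set enorm (A x) | x in [set x | enorm x <= 1]].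

Definition adjoint (R : realType) (d m : nat)
    (A : {linear 'cV[R]_d -> 'cV[R]_m}) (y : 'cV[R]_m) : 'cV[R]_d :=
  \col_j dot (A (delta_mx j 0)) y.

Lemma adjointP (R : realType) (d m : nat)
    (A : {linear 'cV[R]_d -> 'cV[R]_m}) (x : 'cV[R]_d) (y : 'cV[R]_m) :
  dot (A x) y = dot x (adjoint A y).
Proof.
have xE : x = \sum_(j < d) x j 0 *: delta_mx j 0.
  by rewrite {1}[x]matrix_sum_delta; apply: eq_bigr => j _; rewrite big_ord1.
have AxE k : A x k 0 = \sum_(j < d) x j 0 * A (delta_mx j 0) k 0.
  rewrite {1}xE linear_sum summxE; apply: eq_bigr => j _.
  by rewrite linearZ mxE.
rewrite /dot; under eq_bigr => k _ do rewrite AxE mulr_suml.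
rewrite exchange_big; apply: eq_bigr => j _.
rewrite mxE mulr_sumr; apply: eq_bigr => k _.
by rewrite mulrA.
Qed.

Section convex_analysis.
Context (R : realType) (d : nat).
Implicit Types (f : 'cV[R]_d -> \bar R) (x p : 'cV[R]_d).
Local Open Scope ereal_scope.

Definition proper f : Prop :=
  (forall x, f x != -oo) /\ (exists x, f x != +oo).

(* [convex_function] of the library is for finite-valued functions.  For proper
   [f] the right-hand side is never of the form [oo - oo]. *)
Definition econvex f : Prop :=
  forall x y (t : R), (0 < t < 1)%R ->
    f (t *: x + (1 - t) *: y)%R <= t%:E * f x + (1 - t)%:E * f y.

(* A proper convex function is closed iff it is lower semicontinuous. *)
Definition closed_proper_convex f : Prop :=
  [/\ lower_semicontinuous f, proper f & econvex f].

(* Empty at [x] when [f] is proper and [f x = +oo]. *)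
Definition subdiff f x : set 'cV[R]_d :=
  [set p | forall y, f x + (dot p (y - x)%R)%:E <= f y].

Definition bounded_subdiff f : Prop :=
  exists M : R, forall x p, subdiff f x p -> (enorm p <= M)%R.

Definition argmin f : set 'cV[R]_d := [set x | forall y, f x <= f y].

End convex_analysis.

Section problem.
Context (R : realType) (n m : nat) (d : 'I_n -> nat).
Context (f : forall i : 'I_n, 'cV[R]_(d i) -> \bar R).
Context (A : forall i : 'I_n, {linear 'cV[R]_(d i) -> 'cV[R]_m}).
Context (b : 'cV[R]_m).

(* A point [(x_1, ..., x_n)]; block [i] lives in [R^(d i)]. *)
Definition blocks : Type := forall i : 'I_n, 'cV[R]_(d i).

Definition total_map (x : blocks) : 'cV[R]_m := \sum_(i < n) A i (x i).

Definition feasible (x : blocks) : Prop := total_map x = b.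

Definition optimal (x : blocks) : Prop :=
  feasible x /\
  forall y : blocks, feasible y ->
    (\sum_(i < n) f (x i) <= \sum_(i < n) f (y i))%E.

Definition KKT_point (x : blocks) (lam : 'cV[R]_m) : Prop :=
  feasible x /\
  forall i : 'I_n, subdiff (@f i) (x i) (- adjoint (A i) lam).

Definition lambda_hat (beta : R) (x : blocks) (lam : 'cV[R]_m) : 'cV[R]_m :=
  lam + beta *: (total_map x - b).

(* The initial point [(x 0, lam 0)] is unconstrained. *)
Definition LADMPSAP (eta : 'I_n -> R) (beta : nat -> R)
    (x : nat -> blocks) (lam : nat -> 'cV[R]_m) : Prop :=
  forall k : nat,
    (forall i : 'I_n,
      argmin
        (fun z : 'cV[R]_(d i) =>
          (f z + (eta i * beta k / 2 *
             enorm (z - x k i + (eta i * beta k)^-1 *: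
               adjoint (A i) (lambda_hat (beta k) (x k) (lam k))) ^+ 2)%:E)%E)
        (x k.+1 i)) /\
    lam k.+1 = lam k + beta k *: (total_map (x k.+1) - b).

End problem.

(* Main.v *)
Require Import Defs.
From mathcomp Require Import all_boot all_order all_algebra.
From mathcomp Require Import all_classical all_reals all_analysis.
From mathcomp Require Import ring lra.

Set Implicit Arguments.
Unset Strict Implicit.

Import Order.TTheory GRing.Theory Num.Theory.
Import numFieldNormedType.Exports.

Local Open Scope classical_set_scope.
Local Open Scope ring_scope.

(** Why the iterates converge.  For a KKT point [(xs, ls)] consider the energy
    [\sum_i eta i * |x k i - xs i|^2 + beta k ^ -2 * |lam k - ls|^2].  The
    optimality condition of each subproblem yields a subgradient of [f i] at
    [x k.+1 i] (lemma [prox_subgradient]); inserting it into the subgradient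
    inequality and summing over the blocks gives [energy_descent]: in one step
    the energy drops by at least a positive multiple of the squared steps, plus
    the squared constraint residual, plus [2 / beta k] times the total gap, where
    the gap measures how far [x k.+1] is from minimizing the Lagrangian at [ls].
    Hence the iterates are bounded, steps and residuals tend to [0], and since
    the series of the [1 / beta k] diverges, the gap tends to [0] along some
    subsequence ([small_along_divergent_series]).  By compactness the iterates
    converge to a feasible point [xb] along an ultrafilter [U] on the indices
    that refines this subsequence ([ultra_limit_point]).

    It remains to find a multiplier [lb] such that [(xb, lb)] is a KKT point
    whose energy tends to [0] along [U].  That energy is nonincreasing as well,
    so it then tends to [0], which is the convergence of the whole sequence
    ([KKT_limit]); and [xb] is optimal ([KKT_optimal]).

    If [beta] is bounded, the multipliers are bounded too, and [lb] is their
    limit along [U]: the subgradients of the subproblems converge to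
    [- adjoint (A i) lb] and the graph of the subdifferential is closed
    ([subdiff_closed]).

    If [beta] is unbounded, [lb] is [ls] itself: [- adjoint (A i) ls] is an
    [e]-subgradient of [f i] at [x k.+1 i] with [e] the gap, so it is a
    subgradient at [xb i].  The multiplier part of the energy tends to [0]
    because bounded subgradients and surjectivity of the constraint map force
    [lam k / beta k] to [0] ([multiplier_negligible]). *)

(** * Euclidean geometry of column vectors *)

Section euclid.
Context (R : realType).

Section fixed_dim.
Context (d : nat).
Implicit Types u v w : 'cV[R]_d.

Lemma dotC u v : dot u v = dot v u.
Proof. by apply: eq_bigr => i _; rewrite mulrC. Qed.

Lemma dotDl u v w : dot (u + v) w = dot u w + dot v w.
Proof. by rewrite -big_split; apply: eq_bigr => i _; rewrite mxE mulrDl. Qed.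

Lemma dotDr u v w : dot w (u + v) = dot w u + dot w v.
Proof. by rewrite dotC dotDl !(dotC w). Qed.

Lemma dotZl a u v : dot (a *: u) v = a * dot u v.
Proof. by rewrite mulr_sumr; apply: eq_bigr => i _; rewrite mxE mulrA. Qed.

Lemma dotZr a u v : dot u (a *: v) = a * dot u v.
Proof. by rewrite dotC dotZl dotC. Qed.

Lemma dotNl u v : dot (- u) v = - dot u v.
Proof. by rewrite -scaleN1r dotZl mulN1r. Qed.

Lemma dotNr u v : dot u (- v) = - dot u v.
Proof. by rewrite dotC dotNl dotC. Qed.

Lemma dotBr u v w : dot w (u - v) = dot w u - dot w v.
Proof. by rewrite dotDr dotNr. Qed.

Lemma dot0l u : dot 0 u = 0.
Proof. by rewrite -(scale0r u) dotZl mul0r. Qed.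

Lemma dot0r u : dot u 0 = 0.
Proof. by rewrite dotC dot0l. Qed.

Definition dotE := (dotDl, dotDr, dotNl, dotNr, dotZl, dotZr).

Lemma dot_sumr (I : finType) u (F : I -> 'cV[R]_d) :
  dot u (\sum_i F i) = \sum_i dot u (F i).
Proof.
apply: (big_morph (dot u)) => [v w|]; first exact: dotDr.
exact: dot0r.
Qed.

Lemma dot_suml (I : finType) u (F : I -> 'cV[R]_d) :
  dot (\sum_i F i) u = \sum_i dot (F i) u.
Proof. by rewrite dotC dot_sumr; apply: eq_bigr => i _; rewrite dotC. Qed.

Lemma dot_delta u (j : 'I_d) : dot (delta_mx j 0) u = u j 0.
Proof.
rewrite /dot (bigD1 j) //= big1 => [|i /negPf ij].
  by rewrite mxE !eqxx mul1r addr0.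
by rewrite mxE ij mul0r.
Qed.

Lemma dot_ge0 u : 0 <= dot u u.
Proof. by apply: sumr_ge0 => i _; rewrite -expr2 sqr_ge0. Qed.

Lemma sqr_coord_le_dot u (j : 'I_d) : u j 0 ^+ 2 <= dot u u.
Proof.
rewrite /dot (bigD1 j) //= -expr2 lerDl.
by apply: sumr_ge0 => i _; rewrite -expr2 sqr_ge0.
Qed.

Lemma enorm_ge0 u : 0 <= enorm u.
Proof. exact: sqrtr_ge0. Qed.

Lemma sqr_enorm u : enorm u ^+ 2 = dot u u.
Proof. by rewrite sqr_sqrtr ?dot_ge0. Qed.

Lemma coord_le_enorm u (j : 'I_d) : `|u j 0| <= enorm u.
Proof. by rewrite -sqrtr_sqr ler_wsqrtr ?sqr_coord_le_dot. Qed.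

Lemma enormZ a u : enorm (a *: u) = `|a| * enorm u.
Proof. by rewrite /enorm dotZl dotZr mulrA -expr2 sqrtrM ?sqr_ge0 // sqrtr_sqr. Qed.

(** The discriminant of the nonnegative quadratic
    [t |-> dot (u - t *: v) (u - t *: v)], evaluated at its minimizer. *)
Lemma cauchy_schwarz u v : dot u v ^+ 2 <= dot u u * dot v v.
Proof.
have [v0|v_gt0] := eqVneq (dot v v) 0.
  have -> : v = 0.
    apply/matrixP => i j; rewrite ord1 mxE; apply/eqP; rewrite -sqrf_eq0.
    by rewrite eq_le sqr_ge0 andbT -v0 sqr_coord_le_dot.
  by rewrite !dot0r expr0n /= mulr0.
have {}v_gt0 : 0 < dot v v by rewrite lt0r v_gt0 dot_ge0.
have := dot_ge0 (dot v v *: u - dot u v *: v).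
rewrite !dotE (dotC v u) => H.
rewrite -(ler_pM2l v_gt0); lra.
Qed.

Lemma dot_le_enorm u v : `|dot u v| <= enorm u * enorm v.
Proof.
rewrite -ler_sqr ?nnegrE ?mulr_ge0 ?enorm_ge0 //.
by rewrite real_normK ?num_real // exprMn !sqr_enorm cauchy_schwarz.
Qed.

Lemma enormD u v : enorm (u + v) <= enorm u + enorm v.
Proof.
rewrite -ler_sqr ?nnegrE ?addr_ge0 ?enorm_ge0 // sqr_enorm sqrrD !sqr_enorm.
have := le_trans (ler_norm _) (dot_le_enorm u v).
rewrite !dotE (dotC v u); lra.
Qed.

Lemma enorm0 : enorm (0 : 'cV[R]_d) = 0.
Proof. by rewrite /enorm dot0l sqrtr0. Qed.

Lemma enorm_sum (I : finType) (F : I -> 'cV[R]_d) :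
  enorm (\sum_i F i) <= \sum_i enorm (F i).
Proof.
elim/big_ind2 : _ => [|u a v b ua vb|//]; first by rewrite enorm0.
by rewrite (le_trans (enormD _ _))// lerD.
Qed.

End fixed_dim.

Lemma sqr_sum_le n (a : 'I_n -> R) :
  (\sum_i a i) ^+ 2 <= n%:R * \sum_i a i ^+ 2.
Proof.
have := cauchy_schwarz (const_mx 1 : 'cV[R]_n) (\col_i a i).
rewrite /dot; under eq_bigr do rewrite !mxE mul1r.
under [X in _ <= X * _]eq_bigr do rewrite !mxE mul1r.
by under [X in _ <= _ * X]eq_bigr do rewrite !mxE -expr2;
  rewrite sumr_const card_ord.
Qed.

Lemma dot_sum_le n m (u : 'I_n -> 'cV[R]_m) :
  dot (\sum_i u i) (\sum_i u i) <= n%:R * \sum_i dot (u i) (u i).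
Proof.
rewrite /dot exchange_big mulr_sumr; apply: ler_sum => j _.
rewrite summxE -expr2; apply: (le_trans (sqr_sum_le _)).
by rewrite ler_wpM2l ?ler0n.
Qed.

Section linear_maps.
Context (d m : nat) (A : {linear 'cV[R]_d -> 'cV[R]_m}).

Lemma linear_bounded : exists2 C, 0 <= C &
  forall v, enorm (A v) <= C * enorm v.
Proof.
exists (\sum_j enorm (A (delta_mx j 0))) => [|v].
  by apply: sumr_ge0 => j _; exact: enorm_ge0.
have {1}-> : v = \sum_(j < d) v j 0 *: delta_mx j 0.
  by rewrite {1}[v]matrix_sum_delta; apply: eq_bigr => j _; rewrite big_ord1.
rewrite linear_sum mulr_suml (le_trans (enorm_sum _))//; apply: ler_sum => j _.
by rewrite linearZ enormZ mulrC ler_wpM2l ?enorm_ge0 ?coord_le_enorm.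
Qed.

Lemma enorm_le_op_norm v : enorm (A v) <= op_norm A * enorm v.
Proof.
have [C C0 AC] := linear_bounded.
have [v0|v_neq0] := eqVneq (enorm v) 0.
  by rewrite v0 mulr0 (le_trans (AC v))// v0 mulr0.
have v_gt0 : 0 < enorm v by rewrite lt0r v_neq0 enorm_ge0.
rewrite -ler_pdivrMr // /op_norm.
apply: (@ub_le_sup _ [set enorm (A y) | y in [set y | enorm y <= 1]]).
  exists C => _ [w w1 <-].
  by rewrite (le_trans (AC w))// ler_piMr.
exists ((enorm v)^-1 *: v) => /=.
  by rewrite enormZ ger0_norm ?invr_ge0 ?enorm_ge0 // mulVf.
by rewrite linearZ enormZ ger0_norm ?invr_ge0 ?enorm_ge0 // mulrC.
Qed.

Lemma adjointZ a y : adjoint A (a *: y) = a *: adjoint A y.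
Proof. by apply/matrixP => i j; rewrite !mxE dotZr. Qed.

Lemma dot_le_op_norm v : dot (A v) (A v) <= op_norm A ^+ 2 * dot v v.
Proof.
rewrite -!sqr_enorm -exprMn; apply: lerXn2r; rewrite ?nnegrE ?enorm_ge0 //.
  exact: le_trans (enorm_ge0 _) (enorm_le_op_norm v).
exact: enorm_le_op_norm.
Qed.

End linear_maps.

End euclid.

(** * Convergence along a filter *)

Section convergence.
Context (R : realType) (T : Type) (F : set_system T) {FF : Filter F}.

Lemma cvg_colP d (u : T -> 'cV[R]_d) (l : 'cV[R]_d) :
  u @ F --> l <-> forall j, (fun k => u k j 0) @ F --> l j 0.
Proof.
split=> [ul j|ul].
  exact: (cvg_comp _ _ ul (@coord_continuous R d 1 j 0 l)).
apply/cvg_ballP => e e0; rewrite near_map.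
have H : \forall k \near F, forall j, ball (l j 0) e (u k j 0).
  by apply: filter_forall => j; move/cvg_ballP : (ul j); exact.
by apply: filterS H => k ulk; split => // i j; rewrite ord1.
Qed.

Lemma cvg_dot d (u v : T -> 'cV[R]_d) (a b : 'cV[R]_d) :
  u @ F --> a -> v @ F --> b -> (fun k => dot (u k) (v k)) @ F --> dot a b.
Proof.
move=> /cvg_colP ua /cvg_colP vb.
apply: (@cvg_big _ _ +%R) => [|i _]; first exact: add_continuous.
exact: cvgM.
Qed.

Lemma cvg_adjoint d m (A : {linear 'cV[R]_d -> 'cV[R]_m}) (u : T -> 'cV[R]_m) a :
  u @ F --> a -> (fun k => adjoint A (u k)) @ F --> adjoint A a.
Proof.
move=> ua; apply/cvg_colP => j; rewrite mxE.
under eq_fun do rewrite mxE.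
by apply: cvg_dot => //; exact: cvg_cst.
Qed.

Lemma cvg_linear d m (A : {linear 'cV[R]_d -> 'cV[R]_m}) (u : T -> 'cV[R]_d) a :
  u @ F --> a -> (fun k => A (u k)) @ F --> A a.
Proof.
move=> ua; apply/cvg_colP => j; rewrite -dot_delta dotC adjointP.
under eq_fun do rewrite -dot_delta dotC adjointP.
by apply: cvg_dot => //; exact: cvg_cst.
Qed.

Lemma cvg_col0 d (u : T -> 'cV[R]_d) (c : R) (e : T -> R) : 0 < c ->
  (forall k, c * dot (u k) (u k) <= e k) -> e @ F --> 0 ->
  u @ F --> (0 : 'cV[R]_d).
Proof.
move=> c0 ue e0; apply/cvg_colP => j; rewrite mxE.
apply/cvgr0Pnorm_lt => r r0.
have cr0 : 0 < c * r ^+ 2 by rewrite mulr_gt0 ?exprn_gt0.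
move/cvgr0Pnorm_lt : e0 => /(_ _ cr0); apply: filterS => k ek.
rewrite -ltr_sqr ?nnegrE ?(ltW r0)// real_normK ?num_real// -(ltr_pM2l c0).
rewrite (le_lt_trans _ ek)// (le_trans _ (ler_norm _))// (le_trans _ (ue k))//.
by rewrite ler_pM2l// sqr_coord_le_dot.
Qed.

Lemma cvg_bounded_scale d (c : T -> R) (u : T -> 'cV[R]_d) (C : R) :
  (forall k, 0 <= c k <= C) -> u @ F --> (0 : 'cV[R]_d) ->
  (fun k => c k *: u k) @ F --> (0 : 'cV[R]_d).
Proof.
move=> cC u0; have lim : (fun k => C ^+ 2 * dot (u k) (u k)) @ F --> 0.
  have <- : C ^+ 2 * dot (0 : 'cV[R]_d) 0 = 0 by rewrite dot0l mulr0.
  by apply: cvgM; [exact: cvg_cst | exact: cvg_dot].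
apply: (cvg_col0 ltr01 _ lim) => k; have /andP[c0 ck] := cC k.
rewrite mul1r dotZl dotZr mulrA -expr2 ler_wpM2r ?dot_ge0//.
by rewrite ler_sqr ?nnegrE// (le_trans c0).
Qed.

Lemma cvg_scale_bounded d (c : T -> R) (u : T -> 'cV[R]_d) (M : R) :
  c @ F --> 0 -> (forall k, enorm (u k) <= M) ->
  (fun k => c k *: u k) @ F --> (0 : 'cV[R]_d).
Proof.
move=> c0 uM; have lim : (fun k => c k * c k * M ^+ 2) @ F --> 0.
  have <- : 0 * 0 * M ^+ 2 = 0 by rewrite !mul0r.
  by apply: cvgM; [exact: cvgM | exact: cvg_cst].
apply: (cvg_col0 ltr01 _ lim) => k.
rewrite mul1r dotZl dotZr mulrA ler_wpM2l -?expr2 ?sqr_ge0// -sqr_enorm.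
by rewrite ler_sqr ?nnegrE ?enorm_ge0// (le_trans (enorm_ge0 _) (uM k)).
Qed.

End convergence.

(** Bolzano-Weierstrass, with an ultrafilter in place of a subsequence: one
    ultrafilter serves for all the blocks and the multiplier at the same time. *)
Lemma ultra_bounded_cvg (R : realType) (T : Type) (U : set_system T) d
    (u : T -> 'cV[R]_d) (M : R) : UltraFilter U ->
  (forall k, dot (u k) (u k) <= M) -> exists l : 'cV[R]_d, u @ U --> l.
Proof.
move=> UU uM.
have coord j : exists l : R, (fun k => u k j 0) @ U --> l.
  (* [t ^ 2 <= M] implies [`|t| <= M + 1]. *)
  have cpt := @segment_compact R (- (M + 1)) (M + 1).
  have U1 : \forall k \near U, `[- (M + 1), M + 1]%classic (u k j 0).
    suff H k : `[- (M + 1), M + 1]%classic (u k j 0).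
      by apply: filterE => k; exact: H.
    rewrite /= in_itv /= -ler_norml.
    have := le_trans (sqr_coord_le_dot (u k) j) (uM k).
    rewrite -(real_normK (num_real _)) => H.
    have := sqr_ge0 (`|u k j 0| - 1); have := sqr_ge0 `|u k j 0|; nra.
  have [l [_ clu]] := cpt ((fun k => u k j 0) @ U) _ U1.
  exists l => V /= nV.
  have [//|nUV] := in_ultra_setVsetC ((fun k => u k j 0) @^-1` V) UU.
  by have [y [/= ]] := clu (~` V) V nUV nV.
have [l ul] := choice coord.
by exists (\col_j l j); apply/cvg_colP => j; rewrite mxE.
Qed.

(** * Subgradients *)

Section subgradients.
Context (R : realType) (d : nat) (f : 'cV[R]_d -> \bar R).
Context (f_proper : Defs.proper f).

Lemma subdiff_fin_num z p : subdiff f z p -> f z \is a fin_num.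
Proof.
case: f_proper => fNy [y fy] /(_ y); rewrite fin_numE fNy /=.
by case: (f z) => //=; rewrite leye_eq (negPf fy).
Qed.

(** Comparing the minimizer [z] with [t *: y + (1 - t) *: z] and letting [t] go
    to [0] removes the quadratic term in [y - z]. *)
Lemma prox_subgradient (al : R) (a w z : 'cV[R]_d) : econvex f -> 0 < al ->
  argmin (fun y => f y + (al / 2 * enorm (y - a + w) ^+ 2)%:E)%E z ->
  subdiff f z (- (al *: (z - a + w))).
Proof.
move=> f_cvx al0 zmin y; case: f_proper => fNy [y0 fy0].
have : f z \is a fin_num.
  rewrite fin_numE fNy /=; apply/eqP => fz; move: (zmin y0).
  by rewrite fz leye_eq; case: (f y0) fy0.
move/fineK; move: (fine _) => r fzr.
case fys : (f y) (fNy y) => [s| |] // _; last by rewrite leey.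
rewrite -fzr -EFinD lee_fin leNgt; apply/negP => lt_s.
set q := z - a + w in lt_s *; set v := y - z in lt_s *.
pose D := dot v v.
pose del := r - s - al * dot q v.
have del0 : 0 < del by move: lt_s; rewrite /del dotNl dotZl; lra.
have D0 : 0 <= al * D by rewrite mulr_ge0 ?dot_ge0// ltW.
(* The comparison at [t] reads [t * del <= t ^ 2 * (al * D / 2)]; this [t] lies
   in the open unit interval and makes [t * (al * D / 2)] smaller than [del]. *)
pose t := del / (2 * del + al * D).
have den0 : 0 < 2 * del + al * D by lra.
have t0 : 0 < t by rewrite divr_gt0.
have t1 : t < 1 by rewrite ltr_pdivrMr//; lra.
have tE : t * (2 * del + al * D) = del by rewrite divfK// gt_eqF.
have t01 : 0 < t < 1 by rewrite t0.
have /= := le_trans (zmin (t *: y + (1 - t) *: z))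
  (leeD2r _ (f_cvx y z t t01)).
rewrite fys -fzr -!EFinM -!EFinD lee_fin !sqr_enorm -/q.
have -> : t *: y + (1 - t) *: z - a + w = q + t *: v.
  by rewrite /q /v; apply/matrixP => i j; rewrite !mxE; ring.
clearbody q v; rewrite !dotE (dotC v q) -/D => H.
have {}H : t * del <= t * (t * (al * D / 2)) by rewrite /del; lra.
rewrite ler_pM2l// in H.
have := mulr_gt0 t0 del0; lra.
Qed.

(** The graph of the subdifferential is closed, and more generally limits of
    [e]-subgradients with [e] tending to [0] are subgradients. *)
Lemma subdiff_closed (T : Type) (F : set_system T) {FF : ProperFilter F}
    (u p : T -> 'cV[R]_d) (e : T -> R) z q : lower_semicontinuous f ->
  u @ F --> z -> p @ F --> q -> e @ F --> 0 ->
  (forall k y, f (u k) + (dot (p k) (y - u k))%:E <= f y + (e k)%:E)%E ->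
  subdiff f z q.
Proof.
move=> f_lsc uz pq e0 sub y; case: f_proper => fNy _.
case fys : (f y) (fNy y) => [s| |] // _; last by rewrite leey.
rewrite leNgt; apply/negP => lt_s.
(* A real level below [f z], which may be infinite, that still violates the
   inequality at [y]: lower semicontinuity turns it into a bound on [f (u k)]. *)
have [r rlt sr] : exists2 r, (r%:E < f z)%E & s < r + dot q (y - z).
  case: (f z) lt_s (fNy z) => [v| |] //=.
    rewrite -EFinD lte_fin => lt_s _.
    by exists (v - (v + dot q (y - z) - s) / 2); rewrite ?lte_fin; lra.
  by move=> _ _; exists (s - dot q (y - z) + 1); rewrite ?ltry//; lra.
have [V nV Vr] := f_lsc z r rlt.
have lim : (fun k => dot (p k) (y - u k) - e k) @ F --> dot q (y - z) - 0.
  by apply: cvgB => //; apply: cvg_dot => //; apply: cvgB => //; exact: cvg_cst.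
rewrite subr0 in lim.
have /(cvgr_gt _ lim) gt : s - r < dot q (y - z) by lra.
have uV : \forall k \near F, V (u k) by exact: uz.
have [k [Vk ltk]] := filter_ex (filterI uV gt).
have := sub k y; have := Vr _ Vk; rewrite fys /= in ltk *.
case: (f (u k)) => [v| |] //=; rewrite -?EFinD ?lte_fin ?lee_fin; lra.
Qed.

End subgradients.

(** * Sequences weighted by a divergent series *)

(** If [g] stayed above [e] from [N] on, telescoping would bound the partial
    sums of [w]. *)
Lemma small_along_divergent_series (R : realType) (w g Phi : nat -> R) :
  (forall k, 0 <= w k) -> (\sum_(1 <= k <oo) (w k)%:E = +oo)%E ->
  (forall k, 0 <= Phi k) -> (forall k, Phi k.+1 + w k * g k <= Phi k) ->
  forall (e : R) N, 0 < e -> exists2 k, (N <= k)%N & g k < e.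
Proof.
move=> w0 wdiv Phi0 dec e N e0; apply: contrapT => Hno.
have ge k : (N <= k)%N -> e <= g k.
  by move=> Nk; rewrite leNgt; apply/negP => gk; apply: Hno; exists k.
(* The series starts at [1], hence the reference index [N.+1] below. *)
pose S K := \sum_(1 <= k < K) w k.
have Smono : {homo S : a b / (a <= b)%N >-> a <= b}.
  apply: homo_leq => [//|? ? ?|K]; first exact: le_trans.
  rewrite /S; case: K => [|K]; first by rewrite !big_geq.
  by rewrite [leRHS]big_nat_recr//= lerDl.
have tele j : e * S (N.+1 + j)%N + Phi (N.+1 + j)%N <= e * S N.+1 + Phi N.+1.
  elim: j => [|j IH]; first by rewrite addn0.
  rewrite addnS; apply: le_trans IH; rewrite /S big_nat_recr//= mulrDr -addrA.
  rewrite lerD2l; apply: le_trans (dec _); rewrite addrC lerD2l mulrC.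
  by rewrite ler_wpM2l// ge// ltnW// leq_addr.
have Sle K : S K <= S N.+1 + Phi N.+1 / e.
  apply: (@le_trans _ _ (S (N.+1 + K)%N)); first by rewrite Smono// leq_addl.
  rewrite -(ler_pM2l e0) mulrDr [e * (_ / _)]mulrC divfK ?gt_eqF//.
  by apply: le_trans (tele K); rewrite lerDl.
have : (\sum_(1 <= k <oo) (w k)%:E <= (S N.+1 + Phi N.+1 / e)%:E)%E.
  have cvgS : cvgn (fun K => \sum_(1 <= k < K) (w k)%:E)%E.
    by apply: is_cvg_nneseries => k _ _ /=; rewrite lee_fin.
  apply: (lime_le cvgS); apply: nearW => K.
  by rewrite sumEFin lee_fin; exact: Sle.
by rewrite wdiv.
Qed.

(** * The energy of an iteration *)

Section iteration.
Context (R : realType) (n m : nat) (d : 'I_n -> nat).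
Context (f : forall i : 'I_n, 'cV[R]_(d i) -> \bar R).
Arguments f : clear implicits.
Context (A : forall i : 'I_n, {linear 'cV[R]_(d i) -> 'cV[R]_m}).
Context (b : 'cV[R]_m).
Context (f_cpc : forall i : 'I_n, closed_proper_convex (f i)).

Lemma f_proper i : Defs.proper (f i). Proof. by case: (f_cpc i). Qed.

Lemma dot_total_map (y : blocks R d) lam :
  dot (total_map A y) lam = \sum_i dot (y i) (adjoint (A i) lam).
Proof. by rewrite dot_suml; apply: eq_bigr => i _; rewrite adjointP. Qed.

Lemma total_mapB (y z : blocks R d) :
  total_map A y - total_map A z = \sum_i A i (y i - z i).
Proof. by rewrite -sumrB; apply: eq_bigr => i _; rewrite linearB. Qed.

(** On the feasible set the linear terms of the [n] subgradient inequalities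
    add up to [0]. *)
Lemma KKT_optimal xs ls : KKT_point f A b xs ls -> optimal f A b xs.
Proof.
move=> [xs_feas xs_sub]; split=> // y y_feas.
have fin i : f i (xs i) \is a fin_num.
  exact (subdiff_fin_num (f_proper i) (xs_sub i)).
apply: le_trans (lee_sum _ (fun i _ => xs_sub i (y i))).
under eq_bigr do rewrite -(fineK (fin _)).
under [leRHS]eq_bigr do rewrite -(fineK (fin _)) -EFinD.
rewrite !sumEFin lee_fin big_split /= lerDl.
have -> : \sum_i dot (- adjoint (A i) ls) (y i - xs i) =
          - dot (total_map A y - total_map A xs) ls.
  rewrite total_mapB dot_suml -sumrN; apply: eq_bigr => i _.
  by rewrite adjointP dotNl dotC.
by rewrite xs_feas y_feas subrr dot0l oppr0.
Qed.

Context (eta : 'I_n -> R) (beta : nat -> R).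
Context (x : nat -> blocks R d) (lam : nat -> 'cV[R]_m).
Context (beta_gt0 : forall k, 0 < beta k) (eta_gt0 : forall i, 0 < eta i).
Context (run : LADMPSAP f A b eta beta x lam).

Definition step k i := x k.+1 i - x k i.
Definition residual k := total_map A (x k) - b.
Definition hat k := lambda_hat A b (beta k) (x k) (lam k).

(** The subgradient of [f i] at [x k.+1 i] that the optimality condition of the
    [i]-th subproblem provides. *)
Definition prox_grad k i :=
  - ((eta i * beta k) *: step k i) - adjoint (A i) (hat k).

Lemma prox_gradP k i : subdiff (f i) (x k.+1 i) (prox_grad k i).
Proof.
have [_ _ f_cvx] := f_cpc i.
have al0 : 0 < eta i * beta k by rewrite mulr_gt0.
have := prox_subgradient (f_proper i) f_cvx al0 ((run k).1 i).
by rewrite scalerDr opprD scalerA divff ?gt_eqF// scale1r.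
Qed.

Lemma f_x_fin_num k i : f i (x k.+1 i) \is a fin_num.
Proof. exact (subdiff_fin_num (f_proper i) (@prox_gradP k i)). Qed.

Lemma lamS k : lam k.+1 = lam k + beta k *: residual k.+1.
Proof. exact: (run k).2. Qed.

Lemma hatE k : hat k = lam k + beta k *: residual k.
Proof. by []. Qed.

Section energy.
Context (xs : blocks R d) (ls : 'cV[R]_m) (kkt : KKT_point f A b xs ls).

Definition energy k :=
  \sum_i eta i * dot (x k i - xs i) (x k i - xs i) +
  (beta k)^-1 ^+ 2 * dot (lam k - ls) (lam k - ls).

(** The amount by which [x k.+1 i] fails to minimize the [i]-th term of the
    Lagrangian at [ls], that is, the Bregman distance of [f i] from [xs i] to
    [x k.+1 i]. *)
Definition gap k i :=
  fine (f i (x k.+1 i)) - fine (f i (xs i)) +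
  dot (adjoint (A i) ls) (x k.+1 i - xs i).

Lemma f_xs_fin_num i : f i (xs i) \is a fin_num.
Proof. exact (subdiff_fin_num (f_proper i) (kkt.2 i)). Qed.

Lemma gap_ge0 k i : 0 <= gap k i.
Proof.
have := kkt.2 i (x k.+1 i).
rewrite -(fineK (f_xs_fin_num i)) -(fineK (f_x_fin_num k i)) -EFinD lee_fin.
rewrite dotNl /gap; lra.
Qed.

(** The subgradient inequality at [x k.+1 i], evaluated at [xs i], bounds the gap
    by the monotonicity product of [prox_grad k i] and [- adjoint (A i) ls]. *)
Lemma gap_le k i : gap k i <=
  - dot (eta i * beta k *: step k i + adjoint (A i) (hat k - ls))
        (x k.+1 i - xs i).
Proof.
have := @prox_gradP k i (xs i).
rewrite -(fineK (f_xs_fin_num i)) -(fineK (f_x_fin_num k i)) -EFinD lee_fin.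
rewrite /gap /prox_grad -(opprB (x k.+1 i)); move: (x k.+1 i - xs i) => v.
rewrite !(dotDl, dotNl, dotNr) ![dot (adjoint (A i) _) v]dotC -!adjointP dotBr.
lra.
Qed.

(** What remains of [\sum_i eta i * |step k i|^2] once the squared change of the
    residual, at most [n * \sum_i op_norm (A i) ^ 2 * |step k i|^2], has been
    paid for. *)
Definition slack k :=
  \sum_i (eta i - n%:R * op_norm (A i) ^+ 2) * dot (step k i) (step k i).

(** The fundamental estimate.  Add up [gap_le]: the terms along [step] turn
    into differences of squares by polarization, and so do the terms along
    [hat - ls], because both [hat k] and [lam k.+1] differ from [lam k] by
    [beta k] times a residual.  The mismatch between the two residuals is
    [\sum_i A i (step k i)], whose square is the part of [eta i] lost in
    [slack].  Passing from [beta k] to the larger [beta k.+1] can only lower the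
    weight of the multiplier in the energy. *)
Lemma energy_descent k : beta k <= beta k.+1 ->
  energy k.+1 + slack k + dot (residual k) (residual k) +
  2 / beta k * \sum_i gap k i <= energy k.
Proof.
move=> beta_le; have bk := beta_gt0 k; have bk0 : beta k != 0 by rewrite gt_eqF.
set be := beta k in bk bk0 *; pose r := residual k; pose r' := residual k.+1.
pose X' i := x k.+1 i - xs i; pose D i := dot (step k i) (step k i).
have gaps : \sum_i gap k i <=
    - (be * \sum_i eta i * dot (step k i) (X' i)) - dot r' (hat k - ls).
  have -> : dot r' (hat k - ls) = \sum_i dot (X' i) (adjoint (A i) (hat k - ls)).
    rewrite /r' /residual -kkt.1 total_mapB dot_suml.
    by apply: eq_bigr => i _; rewrite adjointP.
  rewrite mulr_sumr -!sumrN -big_split /=; apply: ler_sum => i _.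
  apply: (le_trans (gap_le k i)).
  by rewrite dotDl dotZl -/be [dot (adjoint _ _) _]dotC -/(X' i); lra.
have polar : 2 * \sum_i eta i * dot (step k i) (X' i) =
    \sum_i eta i * D i + \sum_i eta i * dot (X' i) (X' i) -
    \sum_i eta i * dot (x k i - xs i) (x k i - xs i).
  rewrite mulr_sumr -big_split /= -sumrB; apply: eq_bigr => i _.
  have -> : x k i - xs i = X' i - step k i.
    by rewrite /X' /step; apply/matrixP => p q; rewrite !mxE; ring.
  by rewrite /D; move: (X' i) (step k i) => u v; rewrite !dotE (dotC v u); ring.
(* With [hat k - ls = (lam k - ls) + be *: r] and
   [lam k.+1 - ls = (lam k - ls) + be *: r'], this is the expansion of squares. *)
have mult : be^-1 ^+ 2 * dot (lam k.+1 - ls) (lam k.+1 - ls) =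
    be^-1 ^+ 2 * dot (lam k - ls) (lam k - ls) +
    2 / be * dot r' (hat k - ls) + dot (r' - r) (r' - r) - dot r r.
  rewrite lamS hatE -/r -/r' -/be.
  rewrite ![_ + _ *: _ - ls]addrAC; move: (lam k - ls) (r) (r') => u v w.
  rewrite !dotE (dotC v w) (dotC u w); field.
  exact: bk0.
have mismatch : dot (r' - r) (r' - r) <=
    \sum_i n%:R * op_norm (A i) ^+ 2 * D i.
  have -> : r' - r = \sum_i A i (step k i).
    by rewrite -total_mapB /r' /r /residual opprB addrA subrK.
  apply: (le_trans (dot_sum_le _)); rewrite mulr_sumr; apply: ler_sum => i _.
  by rewrite -mulrA ler_wpM2l ?ler0n// dot_le_op_norm.
have slackE : slack k =
    \sum_i eta i * D i - \sum_i n%:R * op_norm (A i) ^+ 2 * D i.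
  by rewrite -sumrB; apply: eq_bigr => i _; rewrite mulrBl.
have weight : (beta k.+1)^-1 ^+ 2 * dot (lam k.+1 - ls) (lam k.+1 - ls) <=
    be^-1 ^+ 2 * dot (lam k.+1 - ls) (lam k.+1 - ls).
  rewrite ler_wpM2r ?dot_ge0//.
  rewrite ler_sqr ?nnegrE ?invr_ge0 ?(ltW bk) ?(ltW (beta_gt0 _))//.
  by rewrite lef_pV2 ?posrE.
have {}gaps : 2 / be * \sum_i gap k i <=
    - (2 * \sum_i eta i * dot (step k i) (X' i)) -
    2 / be * dot r' (hat k - ls).
  have /ler_wpM2l /(_ _ _ gaps) : 0 <= 2 / be by rewrite divr_ge0 ?ltW.
  rewrite mulrBr mulrN mulrA divfK//.
rewrite /energy slackE -/be -/r -/(X' _); lra.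
Qed.

(** The gap is exactly the error that occurs when a subgradient at [xs i] is used
    at [x k.+1 i] instead. *)
Lemma gap_subgradient k i (y : 'cV[R]_(d i)) :
  (f i (x k.+1 i) + (dot (- adjoint (A i) ls) (y - x k.+1 i))%:E <=
   f i y + (gap k i)%:E)%E.
Proof.
apply: le_trans (leeD2r _ (kkt.2 i y)).
rewrite -(fineK (f_xs_fin_num i)) -(fineK (f_x_fin_num k i)) -!EFinD lee_fin.
by rewrite /gap !(dotDr, dotNl, dotNr) /=; lra.
Qed.

Context (beta_nondecr : nondecreasing_seq beta).
Context (eta_large : forall i : 'I_n, n%:R * op_norm (A i) ^+ 2 < eta i).

Lemma energy_ge0 k : 0 <= energy k.
Proof.
apply: addr_ge0; last by rewrite mulr_ge0 ?sqr_ge0 ?dot_ge0.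
by apply: sumr_ge0 => i _; rewrite mulr_ge0 ?dot_ge0// ltW.
Qed.

Lemma slack_ge k i :
  (eta i - n%:R * op_norm (A i) ^+ 2) * dot (step k i) (step k i) <= slack k.
Proof.
rewrite /slack (bigD1 i)//= lerDl; apply: sumr_ge0 => j _.
by rewrite mulr_ge0 ?dot_ge0// subr_ge0 ltW.
Qed.

Lemma slack_ge0 k : 0 <= slack k.
Proof. by apply: sumr_ge0 => i _; rewrite mulr_ge0 ?dot_ge0// subr_ge0 ltW. Qed.

Lemma gap_sum_ge0 k : 0 <= 2 / beta k * \sum_i gap k i.
Proof.
apply: mulr_ge0; first by rewrite divr_ge0 ?ltW.
by apply: sumr_ge0 => i _; exact: gap_ge0.
Qed.

Lemma energy_nonincreasing : nonincreasing_seq energy.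
Proof.
apply/nonincreasing_seqP => k.
have := energy_descent (beta_nondecr (leqnSn k)).
have := slack_ge0 k; have := dot_ge0 (residual k); have := gap_sum_ge0 k; lra.
Qed.

Lemma energy_drop_cvg0 : (fun k => energy k - energy k.+1) @ \oo --> 0.
Proof.
have cvgE : cvgn energy.
  apply: nonincreasing_is_cvgn energy_nonincreasing _.
  by exists 0 => _ [k _ <-]; exact: energy_ge0.
rewrite -(subrr (limn energy)); apply: cvgB => //.
by rewrite (cvg_shiftS energy).
Qed.

Lemma step_cvg0 i : step ^~ i @ \oo --> (0 : 'cV[R]_(d i)).
Proof.
have c0 : 0 < eta i - n%:R * op_norm (A i) ^+ 2 by rewrite subr_gt0.
apply: (cvg_col0 c0 _ energy_drop_cvg0) => k.
have := energy_descent (beta_nondecr (leqnSn k)); have := @slack_ge k i.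
have := dot_ge0 (residual k); have := gap_sum_ge0 k; lra.
Qed.

Lemma residual_cvg0 : residual @ \oo --> (0 : 'cV[R]_m).
Proof.
apply: (cvg_col0 ltr01 _ energy_drop_cvg0) => k; rewrite mul1r.
have := energy_descent (beta_nondecr (leqnSn k)).
have := slack_ge0 k; have := gap_sum_ge0 k; lra.
Qed.

Lemma energy_ge_x k i : eta i * dot (x k i - xs i) (x k i - xs i) <= energy k.
Proof.
rewrite /energy (bigD1 i)//= -addrA lerDl.
apply: addr_ge0; last by rewrite mulr_ge0 ?sqr_ge0 ?dot_ge0.
by apply: sumr_ge0 => j _; rewrite mulr_ge0 ?dot_ge0// ltW.
Qed.

Lemma energy_ge_lam k :
  (beta k)^-1 ^+ 2 * dot (lam k - ls) (lam k - ls) <= energy k.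
Proof.
by rewrite lerDr; apply: sumr_ge0 => j _; rewrite mulr_ge0 ?dot_ge0// ltW.
Qed.

Lemma x_bounded k i :
  dot (x k i - xs i) (x k i - xs i) <= (eta i)^-1 * energy 0.
Proof.
rewrite -(ler_pM2l (eta_gt0 i)) mulVKf ?gt_eqF// (le_trans (energy_ge_x k i))//.
exact: energy_nonincreasing.
Qed.

Lemma lam_bounded B k : (forall j, beta j <= B) ->
  dot (lam k - ls) (lam k - ls) <= B ^+ 2 * energy 0.
Proof.
move=> betaB; have b2 : 0 < beta k ^+ 2 by rewrite exprn_gt0.
apply: (@le_trans _ _ (beta k ^+ 2 * energy 0)).
  rewrite -ler_pdivrMl// -exprVn (le_trans (energy_ge_lam k))//.
  exact: energy_nonincreasing.
have bk := ltW (beta_gt0 k); rewrite ler_wpM2r ?energy_ge0//.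
by rewrite ler_sqr ?nnegrE// (le_trans bk).
Qed.

(** Convergence of the energy to [0] along some filter upgrades to convergence
    of the whole sequence, because the energy is monotone. *)
Lemma KKT_limit (U : set_system nat) : ProperFilter U ->
  (forall i, x ^~ i @ U --> xs i) ->
  (fun k => (beta k)^-1 *: (lam k - ls)) @ U --> (0 : 'cV[R]_m) ->
  forall i, x ^~ i @ \oo --> xs i.
Proof.
move=> UU xU lamU i.
have EU : energy @ U --> 0.
  have -> : energy = fun k =>
      \sum_j eta j * dot (x k j - xs j) (x k j - xs j) +
      dot ((beta k)^-1 *: (lam k - ls)) ((beta k)^-1 *: (lam k - ls)).
    by apply/funext => k; rewrite dotZl dotZr mulrA -expr2.
  rewrite -[X in _ --> X]addr0; apply: cvgD; last first.
    by rewrite -[X in _ --> X](dot0l (0 : 'cV[R]_m)); exact: cvg_dot.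
  have sum0 : \sum_(j < n) (0 : R) = 0 by rewrite big1_eq.
  rewrite -[X in _ --> X]sum0.
  apply: cvg_big => [|j _]; first exact: add_continuous.
  have xj : (fun k => x k j - xs j) @ U --> (0 : 'cV[R]_(d j)).
    by rewrite -(subrr (xs j)); apply: cvgB; [exact: xU | exact: cvg_cst].
  by rewrite -[X in _ --> X](mulr0 (eta j)) -(dot0l (0 : 'cV[R]_(d j)));
    apply: cvgM; [exact: cvg_cst | exact: cvg_dot].
have E0 : energy @ \oo --> 0.
  apply/cvgr0Pnorm_lt => e e0.
  have /cvgr0Pnorm_lt/(_ _ e0)/filter_ex [N EN] := EU.
  exists N => // k /= Nk; rewrite ger0_norm ?energy_ge0//.
  apply: le_lt_trans (energy_nonincreasing Nk) _.
  by rewrite (le_lt_trans (ler_norm _) EN).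
have : (fun k => x k i - xs i) @ \oo --> (0 : 'cV[R]_(d i)).
  by apply: (cvg_col0 (eta_gt0 i) _ E0) => k; exact: energy_ge_x.
move=> /cvg_sub0; apply; exact: cvg_cst.
Qed.

(** The optimality conditions of the subproblems express [adjoint (A i) (hat k)]
    by a bounded subgradient and [beta k] times a vanishing step; since the
    range of [total_map A] is everything, these adjoints control all the
    coordinates of [hat k]. *)
Lemma multiplier_negligible : (fun k => (beta k)^-1) @ \oo --> 0 ->
  (forall c, exists y : blocks R d, total_map A y = c) ->
  (forall i, bounded_subdiff (f i)) ->
  (fun k => (beta k)^-1 *: (lam k - ls)) @ \oo --> (0 : 'cV[R]_m).
Proof.
move=> binv0 onto bnd.
have adj0 i : (fun k => adjoint (A i) ((beta k)^-1 *: hat k)) @ \oo -->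
    (0 : 'cV[R]_(d i)).
  have [M fM] := bnd i.
  have -> : (fun k => adjoint (A i) ((beta k)^-1 *: hat k)) =
      (fun k => - ((beta k)^-1 *: prox_grad k i) - eta i *: step k i).
    apply/funext => k; rewrite adjointZ /prox_grad scalerBr scalerN scalerA.
    by rewrite mulrCA mulVf ?gt_eqF// mulr1 opprB opprK addrK.
  have <- : - 0 - eta i *: 0 = 0 :> 'cV[R]_(d i) by rewrite scaler0 subr0 oppr0.
  apply: cvgB; last by apply: cvgZr; exact: step_cvg0.
  apply: cvgN; apply: (cvg_scale_bounded binv0) => k.
  exact: fM (@prox_gradP k i).
have hat0 : (fun k => (beta k)^-1 *: hat k) @ \oo --> (0 : 'cV[R]_m).
  apply/cvg_colP => j; have [y yj] := onto (delta_mx j 0).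
  under eq_fun do rewrite -dot_delta -yj dot_total_map.
  have -> : (0 : 'cV[R]_m) j 0 = \sum_i dot (y i) 0.
    by rewrite big1 ?mxE// => i _; rewrite dot0r.
  apply: cvg_big => [|i _]; first exact: add_continuous.
  by apply: cvg_dot; [exact: cvg_cst | exact: adj0].
have -> : (fun k => (beta k)^-1 *: (lam k - ls)) =
    (fun k => (beta k)^-1 *: hat k - residual k - (beta k)^-1 *: ls).
  apply/funext => k; rewrite hatE; move: (residual k) => r.
  rewrite !scalerDr scalerA mulVf ?gt_eqF// scale1r.
  by rewrite addrK scalerN.
have <- : 0 - 0 - 0 *: ls = 0 by rewrite scale0r !subr0.
by apply: cvgB; [apply: cvgB => //; exact: residual_cvg0 | exact: cvgZl].
Qed.

(** Both cases of the final argument start from an ultrafilter along which the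
    gaps vanish; by compactness the iterates converge along it, and the
    residuals make the limit feasible. *)
Lemma ultra_limit_point : (\sum_(1 <= k <oo) ((beta k)^-1)%:E = +oo)%E ->
  exists (U : set_system nat) (xb : blocks R d),
    [/\ UltraFilter U, \oo `<=` U, forall i, gap ^~ i @ U --> 0,
        forall i, x ^~ i @ U --> xb i & feasible A b xb].
Proof.
move=> beta_div; pose G k := \sum_i gap k i.
have dec k : energy k.+1 + (beta k)^-1 * (2 * G k) <= energy k.
  have := energy_descent (beta_nondecr (leqnSn k)); rewrite -/(G k).
  by have := slack_ge0 k; have := dot_ge0 (residual k); lra.
have small j : exists k, (j <= k)%N /\ G k < j.+1%:R^-1.
  have e0 : 0 < 2 / j.+1%:R :> R by rewrite divr_gt0.
  have binv0 k : 0 <= (beta k)^-1 by rewrite invr_ge0 ltW.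
  have [k jk Gk] :=
    small_along_divergent_series binv0 beta_div energy_ge0 dec j e0.
  by exists k; split=> //; rewrite -(ltr_pM2l (ltr0n R 2)).
(* [kk] enumerates the subsequence along which the gaps vanish; [j <= kk j] makes
   the image filter finer than [\oo]. *)
have [kk kkP] := choice small.
have [U [UU kkU]] := @ultraFilterLemma _ (kk @ \oo) _.
have ooU : \oo `<=` U.
  move=> V [N _ NV]; apply: kkU; exists N => // j /= Nj; apply: NV => /=.
  exact: leq_trans Nj (kkP j).1.
have GU : G @ U --> 0.
  apply: cvg_trans (cvg_app G kkU) _.
  have := @cvg_harmonic R; apply: squeeze_cvgr _ (@cvg_cst _ _ _ _ _).
  apply: nearW => j /=; rewrite (ltW (kkP j).2) andbT.
  by apply: sumr_ge0 => i _; exact: gap_ge0.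
have lim i : exists l : 'cV[R]_(d i), x ^~ i @ U --> l.
  have [l ul] := ultra_bounded_cvg UU (x_bounded ^~ i).
  exists (l + xs i).
  have -> : x ^~ i = (fun k => x k i - xs i + xs i).
    by apply/funext => k; rewrite subrK.
  by apply: cvgD => //; exact: cvg_cst.
pose xb i := sval (cid (lim i)).
have xU i : x ^~ i @ U --> xb i by exact: svalP (cid (lim i)).
exists U, xb; split=> // [i|].
  apply: squeeze_cvgr (cvg_cst 0) GU; apply: nearW => k; rewrite gap_ge0/=.
  by rewrite /G (bigD1 i)//= lerDl; apply: sumr_ge0 => j _; exact: gap_ge0.
have resU : residual @ U --> total_map A xb - b.
  apply: cvgB; last exact: cvg_cst.
  apply: cvg_big => [|i _]; first exact: add_continuous.
  exact: cvg_linear.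
apply/eqP; rewrite -subr_eq0; apply/eqP.
by apply: norm_cvg_unique resU (cvg_trans (cvg_app _ ooU) residual_cvg0).
Qed.

End energy.

Context (beta_nondecr : nondecreasing_seq beta).
Context (eta_large : forall i : 'I_n, n%:R * op_norm (A i) ^+ 2 < eta i).

Lemma LADMPSAP_cvg : (exists xs ls, KKT_point f A b xs ls) ->
  (forall c, exists y : blocks R d, total_map A y = c) ->
  (\sum_(1 <= k <oo) ((beta k)^-1)%:E = +oo)%E ->
  (forall i, bounded_subdiff (f i)) ->
  exists2 xb, optimal f A b xb & forall i, x ^~ i @ \oo --> xb i.
Proof.
move=> [xs [ls kkt]] onto beta_div bnd.
have [U [xb [UU ooU gapU xU xb_feas]]] :=
  ultra_limit_point kkt beta_nondecr eta_large beta_div.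
have stepU i : step ^~ i @ U --> (0 : 'cV[R]_(d i)).
  exact: cvg_trans (cvg_app _ ooU) (@step_cvg0 _ _ kkt beta_nondecr eta_large i).
have xSU i : (fun k => x k.+1 i) @ U --> xb i.
  have -> : (fun k => x k.+1 i) = (fun k => x k i + step k i).
    by apply/funext => k; rewrite addrC subrK.
  by rewrite -[xb i]addr0; apply: cvgD; [exact: xU | exact: stepU].
have f_lsc i : lower_semicontinuous (f i) by case: (f_cpc i).
suff [lb [kktb lamU]] : exists lb, KKT_point f A b xb lb /\
    (fun k => (beta k)^-1 *: (lam k - lb)) @ U --> (0 : 'cV[R]_m).
  exists xb => [|i]; first exact: KKT_optimal kktb.
  exact (@KKT_limit _ _ kktb beta_nondecr eta_large U _ xU lamU i).
(* For bounded penalties the multiplier is the limit of [lam]; otherwise it is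
   the one of the KKT point that the gaps refer to. *)
have [[B betaB]|unbounded] := pselect (exists B, forall k, beta k <= B).
  have [l lU] := ultra_bounded_cvg UU
    (fun k => lam_bounded kkt beta_nondecr eta_large k betaB).
  have bB k : 0 <= beta k <= B by rewrite betaB ltW.
  have lamU : lam @ U --> l + ls.
    have -> : lam = (fun k => lam k - ls + ls).
      by apply/funext => k; rewrite subrK.
    by apply: cvgD => //; exact: cvg_cst.
  have hatU : hat @ U --> l + ls.
    rewrite -[l + ls]addr0; apply: cvgD => //; apply: (cvg_bounded_scale bB).
    exact: cvg_trans (cvg_app _ ooU) (@residual_cvg0 _ _ kkt beta_nondecr eta_large).
  exists (l + ls); split; first split=> // i.
    have pU : prox_grad ^~ i @ U --> - adjoint (A i) (l + ls).
      rewrite -[X in _ --> X]add0r -oppr0; apply: cvgB; last exact: cvg_adjoint.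
      apply: cvgN; apply: (@cvg_bounded_scale _ _ _ _ _ _ _ (eta i * B)) => [k|].
        have /andP[b0 bb] := bB k.
        by rewrite mulr_ge0 ?ler_wpM2l ?(ltW (eta_gt0 i)).
      exact: stepU.
    apply: (subdiff_closed (f_proper i) (f_lsc i) (xSU i) pU (cvg_cst 0)) => k y.
    by rewrite adde0; exact: prox_gradP.
  apply: (@cvg_bounded_scale _ _ _ _ _ _ _ (beta 0)^-1) => [k|].
    by rewrite invr_ge0 ltW//= lef_pV2 ?posrE// beta_nondecr.
  by rewrite -(subrr (l + ls)); apply: cvgB => //; exact: cvg_cst.
exists ls; split; first split=> // i.
  have cstU : (fun=> - adjoint (A i) ls) @ U --> - adjoint (A i) ls.
    exact: cvg_cst.
  apply: (subdiff_closed (f_proper i) (f_lsc i) (xSU i) cstU (gapU i)) => k y.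
  exact: gap_subgradient.
apply: cvg_trans (cvg_app _ ooU) _.
apply: (multiplier_negligible kkt beta_nondecr eta_large) => //.
apply/cvgr0Pnorm_lt => e e0.
have [N betaN] : exists N, e^-1 < beta N.
  apply: contrapT => H; apply: unbounded; exists e^-1 => k.
  by rewrite leNgt; apply/negP => Hk; apply: H; exists k.
exists N => // k /= Nk; rewrite ger0_norm ?invr_ge0 ?(ltW (beta_gt0 k))//.
rewrite -[e]invrK ltf_pV2 ?posrE ?invr_gt0//.
exact: lt_le_trans betaN (beta_nondecr Nk).
Qed.

End iteration.

Theorem theorem2 (R : realType) (n m : nat) (d : 'I_n -> nat)
    (f : forall i : 'I_n, 'cV[R]_(d i) -> \bar R)
    (A : forall i : 'I_n, {linear 'cV[R]_(d i) -> 'cV[R]_m})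
    (b : 'cV[R]_m)
    (eta : 'I_n -> R) (beta : nat -> R)
    (x : nat -> blocks R d) (lam : nat -> 'cV[R]_m)
    (f_cpc : forall i : 'I_n, closed_proper_convex (f i))
    (A_neq0 : forall i : 'I_n, exists v : 'cV[R]_(d i), A i v <> 0)
    (sol_nonunique : exists y z : blocks R d,
       [/\ feasible A b y, feasible A b z & exists i : 'I_n, y i <> z i])
    (A_onto : forall c : 'cV[R]_m, exists y : blocks R d, total_map A y = c)
    (KKT_ex : exists (xs : blocks R d) (lams : 'cV[R]_m),
       KKT_point f A b xs lams)
    (eta_gt0 : forall i : 'I_n, 0 < eta i)
    (beta_gt0 : forall k : nat, 0 < beta k)
    (run : LADMPSAP f A b eta beta x lam)
    (beta_nondecr : nondecreasing_seq beta)
    (beta_div : (\sum_(1 <= k <oo) ((beta k)^-1)%:E = +oo)%E)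
    (eta_large : forall i : 'I_n, n%:R * op_norm (A i) ^+ 2 < eta i)
    (subdiff_bnd : forall i : 'I_n, bounded_subdiff (f i)) :
  exists xopt : blocks R d,
    optimal f A b xopt /\
    forall i : 'I_n, (fun k : nat => x k i) @ \oo --> xopt i.
Proof.
have [xb xb_opt x_cvg] := LADMPSAP_cvg f_cpc beta_gt0 eta_gt0 run beta_nondecr
  eta_large KKT_ex A_onto beta_div subdiff_bnd.
by exists xb.
Qed.
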